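(* For $n\ge 3$ let $n$-Go denote the equation $$(a_1\to_1a_2)\cap(a_2\to_1a_3)\cap\cdots\cap(a_{n-1}\to_1a_n)\cap(a_n\to_1a_1)=(a_n\to_1a_{n-1})\cap(a_{n-1}\to_1a_{n-2})\cap\cdots\cap(a_2\to_1a_1)\cap(a_1\to_1a_n).$$ Then for every $n\ge 3$ the equation $n$-Go holds in every ortholattice that admits a strong set of (quantum) states. Moreover, for every $n\ge3$, the class of all ortholattices satisfying $n$-Go is a variety strictly smaller than the variety of orthomodular lattices: every ortholattice satisfying $n$-Go is orthomodular, and there is an orthomodular lattice in which $n$-Go fails.
   Context: $\cap$ is meet, $\cup$ is join, $'$ is orthocomplementation. An ortholattice (OL) is a bounded lattice with an order-reversing involutive complementation $'$; an orthomodular lattice (OML) is an OL in which $a\le b$ implies $b=a\cup(a'\cap b)$. $a\to_1 b:=a'\cup(a\cap b)$. $a\perp b$ means $a\le b'$. A state on an ortholattice $L$ is a function $m:L\to[0,1]$ with $m(1)=1$ and $m(a\cup b)=m(a)+m(b)$ whenever $a\perp b$. A nonempty set $S$ of states on $L$ is a strong set of (quantum) states if $$(\forall a,b\in L)(\exists m\in S)\bigl((m(a)=1\Rightarrow m(b)=1)\Rightarrow a\le b\bigr).$$ Here $L$ is assumed to have more than one element. *)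

(* Defs.v *)
From HB Require Import structures.
From mathcomp Require Import all_boot all_order all_algebra.
From mathcomp Require Import classical_sets reals.

Set Implicit Arguments.
Unset Strict Implicit.
Unset Printing Implicit Defensive.

Import Order.Theory.

Local Open Scope order_scope.

HB.mixin Record TBLattice_hasOrthocomplement (d : Order.disp_t) T
    of Order.TBLattice d T := {
  ocompl : T -> T;
  ocomplK : involutive ocompl;
  ocompl_anti : forall a b : T, a <= b -> ocompl b <= ocompl a;
  meet_ocompl : forall a : T, a `&` ocompl a = \bot;
  join_ocompl : forall a : T, a `|` ocompl a = \top }.

#[short(type="orthoLatticeType")]
HB.structure Definition OrthoLattice (d : Order.disp_t) :=
  { T of Order.TBLattice d T & TBLattice_hasOrthocomplement d T }.

Definition orthomodular (d : Order.disp_t) (L : orthoLatticeType d) : Prop :=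
  forall a b : L, a <= b -> b = a `|` (ocompl a `&` b).

Definition orthogonal (d : Order.disp_t) (L : orthoLatticeType d) (a b : L) :=
  a <= ocompl b.

Definition impl1 (d : Order.disp_t) (L : orthoLatticeType d) (a b : L) : L :=
  ocompl a `|` (a `&` b).

(* The a_i are indexed from 0 and [ordS] is the cyclic successor, so the factor
   at the last index is (a_n ->_1 a_1) on the left-hand side and
   (a_1 ->_1 a_n) on the right-hand side. *)
Definition nGo (n : nat) (d : Order.disp_t) (L : orthoLatticeType d) : Prop :=
  forall a : 'I_n -> L,
    \meet_(i < n) impl1 (a i) (a (ordS i))
    = \meet_(i < n) impl1 (a (ordS i)) (a i).

Definition is_state (R : realType) (d : Order.disp_t) (L : orthoLatticeType d)
    (m : L -> R) : Prop :=
  [/\ forall a : L, (0 <= m a <= 1)%R,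
      m \top = 1%R
    & forall a b : L, orthogonal a b -> m (a `|` b) = (m a + m b)%R].

Definition strong_set_of_states (R : realType) (d : Order.disp_t)
    (L : orthoLatticeType d) (S : set (L -> R)) : Prop :=
  [/\ (S !=set0)%classic,
      forall m : L -> R, S m -> is_state m
    & forall a b : L, exists2 m : L -> R,
        S m & ((m a = 1%R -> m b = 1%R) -> a <= b)].

Inductive ol_term : Type :=
  | OLVar of nat
  | OLBot
  | OLTop
  | OLCompl of ol_term
  | OLMeet of ol_term & ol_term
  | OLJoin of ol_term & ol_term.

Fixpoint ol_eval (d : Order.disp_t) (L : orthoLatticeType d) (v : nat -> L)
    (t : ol_term) : L :=
  match t with
  | OLVar i => v i
  | OLBot => \bot
  | OLTop => \top
  | OLCompl t1 => ocompl (ol_eval v t1)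
  | OLMeet t1 t2 => ol_eval v t1 `&` ol_eval v t2
  | OLJoin t1 t2 => ol_eval v t1 `|` ol_eval v t2
  end.

(* A variety is an equational class.  Ortholattices being themselves axiomatized
   by equations in the signature of [ol_term], a class of ortholattices is a
   variety as soon as it is cut out by equations among the ortholattices. *)
Definition is_variety
    (K : forall d : Order.disp_t, orthoLatticeType d -> Prop) : Prop :=
  exists E : ol_term -> ol_term -> Prop,
    forall (d : Order.disp_t) (L : orthoLatticeType d),
      K d L <-> forall (s t : ol_term), E s t ->
                  forall v : nat -> L, ol_eval v s = ol_eval v t.

(* Main.v *)
(** A state that is 1 on a Sasaki implication [a ->1 b] satisfies m(a) = m(a /\ b),
    hence m(a) <= m(b); around a cycle all the values are equal, and the state is
    then also 1 on the reversed implications, so a strong set of states compares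
    one side of n-Go with each factor of the other.

    n-Go at (1, b, c, ..., c) with c <= b and b /\ c' = 0 reads b = c; the choice
    c = a \/ (a' /\ b) gives orthomodularity.

    For the strictness, a graph in which two distinct vertices have at most one
    common neighbour and each edge lies in a triangle is the orthogonality graph
    of the atoms of an orthomodular lattice of height at most 3. In the one below
    (the 16-atom Greechie diagram of Godowski's wheel) the orthocomplements d_i'
    of three atoms satisfy d_i' ->1 d_{i+1}' = g_i' and d_{i+1}' ->1 d_i' = h_i',
    where the central atom is orthogonal to all g_i but to no h_i. The case of
    n > 3 reduces to n = 3 by repeating the last element. *)

From HB Require Import structures.
Require Import Defs.
From mathcomp Require Import all_boot all_order all_algebra.
From mathcomp Require Import classical_sets reals.

Set Implicit Arguments.
Unset Strict Implicit.
Unset Printing Implicit Defensive.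

Import Order.Theory GRing.Theory Num.Theory.

Local Open Scope order_scope.

(** * Ortholattice identities and monotonicity along cycles *)

Lemma le_ocomplC d (L : orthoLatticeType d) (a b : L) :
  a <= ocompl b -> b <= ocompl a.
Proof. by move/ocompl_anti; rewrite ocomplK. Qed.

Lemma ocompl0 d (L : orthoLatticeType d) : ocompl (\bot : L) = \top.
Proof. by rewrite -(join_ocompl \bot) join0x. Qed.

Lemma ocompl1 d (L : orthoLatticeType d) : ocompl (\top : L) = \bot.
Proof. by rewrite -ocompl0 ocomplK. Qed.

Lemma ocomplU d (L : orthoLatticeType d) (a b : L) :
  ocompl (a `|` b) = ocompl a `&` ocompl b.
Proof.
apply: le_anti; apply/andP; split.
  by rewrite lexI !ocompl_anti ?leUl ?leUr.
apply: le_ocomplC; rewrite leUx.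
by apply/andP; split; apply: le_ocomplC; rewrite ?leIl ?leIr.
Qed.

Lemma impl1_le d (L : orthoLatticeType d) (a b : L) :
  a <= b -> impl1 a b = \top.
Proof. by move=> ab; rewrite /impl1 (meet_l ab) joinC join_ocompl. Qed.

Lemma impl1_1x d (L : orthoLatticeType d) (a : L) : impl1 \top a = a.
Proof. by rewrite /impl1 ocompl1 join0x meet1x. Qed.

(** Orbits of an injection of a finite set are cycles: climbing along [s] from [s i] eventually
    returns to [i], so [f (s i) <= f i]. *)
Lemma cyclic_const d (T : porderType d) (I : finType) (s : I -> I)
    (f : I -> T) : injective s ->
  (forall i, f i <= f (s i)) -> forall i, f (s i) = f i.
Proof.
move=> s_inj le_f i; apply: le_anti; rewrite le_f andbT.
have le_iter k j : f j <= f (iter k s j).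
  by elim: k => //= k IH; exact: le_trans IH (le_f _).
have := le_iter (order s (s i)).-1 (s i).
by rewrite -/(finv s (s i)) finv_f.
Qed.

(** * States and n-Go *)

Section States.
Variables (R : realType) (d : Order.disp_t) (L : orthoLatticeType d).
Implicit Types (m : L -> R) (a b : L).
Local Open Scope ring_scope.

Lemma state_ocompl m a : is_state m -> m (ocompl a) = 1 - m a.
Proof.
move=> [_ m1 mU]; rewrite -m1 -(join_ocompl a) mU; first by rewrite addrAC subrr add0r.
by rewrite /Defs.orthogonal ocomplK lexx.
Qed.

(** Since [a] is orthogonal to the orthocomplement of [b], additivity gives m(a) + 1 - m(b) <= 1. *)
Lemma state_le m a b : is_state m -> (a <= b)%O -> m a <= m b.
Proof.
move=> ms ab; have [m01 _ mU] := ms.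
have := mU a (ocompl b); rewrite /Defs.orthogonal ocomplK => /(_ ab) E.
have /andP[_] := m01 (a `|` ocompl b)%O.
by rewrite E state_ocompl // addrCA gerDl subr_le0.
Qed.

Lemma state_impl1 m a b : is_state m ->
  m (impl1 a b) = 1 - m a + m (a `&` b)%O.
Proof.
move=> ms; have [_ _ mU] := ms.
rewrite mU; first by rewrite state_ocompl.
by rewrite /Defs.orthogonal ocompl_anti // leIl.
Qed.

Lemma state_impl1_cycle m (I : finType) (s : I -> I) (a : I -> L) :
    is_state m -> injective s ->
    (forall i, m (impl1 (a i) (a (s i))) = 1) ->
  forall i, m (impl1 (a (s i)) (a i)) = 1.
Proof.
move=> ms s_inj m1 i.
have mI j : m (a j `&` a (s j))%O = m (a j).
  by apply: (addrI (1 - m (a j))); rewrite -state_impl1 // m1 subrK.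
have mS : m (a (s i)) = m (a i).
  apply: (@cyclic_const _ _ _ _ (fun j => m (a j)) s_inj) => j.
  by rewrite -{1}mI state_le // leIr.
by rewrite state_impl1 // meetC mI mS subrK.
Qed.

(** Keeping [s] general lets the cyclic successor and the cyclic predecessor yield the two
    inequalities of n-Go. *)
Lemma strong_states_impl1_cycle (S : set (L -> R)) (I : finType) (s : I -> I)
    (a : I -> L) : strong_set_of_states S -> injective s ->
  (\meet_(i : I) impl1 (a i) (a (s i)) <= \meet_(i : I) impl1 (a (s i)) (a i))%O.
Proof.
move=> [_ Sst Sstrong] s_inj; apply/meetsP => i _.
have [m Sm le_m] := Sstrong (\meet_(j : I) impl1 (a j) (a (s j)))%O
                      (impl1 (a (s i)) (a i)).
apply: le_m => m1; have ms := Sst _ Sm.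
apply: (state_impl1_cycle ms s_inj) => j; apply: le_anti; apply/andP; split.
  by have [/(_ (impl1 (a j) (a (s j))))/andP[]] := ms.
by rewrite -m1 state_le // (@meets_inf _ _ _ j).
Qed.

Lemma nGo_of_strong_states (S : set (L -> R)) n :
  strong_set_of_states S -> nGo n L.
Proof.
move=> strS a; apply: le_anti; apply/andP; split.
  exact: strong_states_impl1_cycle a strS (@ordS_inj n).
(* Reindexing by [ordS] turns the predecessor version into the reverse inequality. *)
have := strong_states_impl1_cycle a strS (@ord_pred_inj n).
rewrite (reindex_inj (@ordS_inj n)) [X in (_ <= X)%O -> _](reindex_inj (@ordS_inj n)).
by under eq_bigr do rewrite ordSK; under [X in (_ <= X)%O]eq_bigr do rewrite ordSK.
Qed.
End States.

(** * From n-Go to orthomodularity *)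

Lemma orthomodular_of_nGo n d (L : orthoLatticeType d) :
  (3 <= n)%N -> nGo n L -> orthomodular L.
Proof.
case: n => [|[|[|n]]] // _ Go a b ab; pose c := a `|` (ocompl a `&` b).
have cb : c <= b by rewrite leUx ab leIr.
have bc : impl1 b c = \top.
  (* The orthocomplement of b' \/ c is (b /\ a') /\ (a' /\ b)', hence bottom. *)
  rewrite /impl1 (meet_r cb) -[LHS]ocomplK ocomplU ocomplK ocomplU meetA.
  by rewrite [b `&` _]meetC meet_ocompl ocompl0.
(* The default value of [nth] supplies all the entries [c] from index 2 on. *)
pose f (i : 'I_n.+3) := nth c [:: \top; b] i.
apply/le_anti; rewrite cb andbT.
suff : b <= \meet_(i < n.+3) impl1 (f i) (f (ordS i)).
  rewrite Go => /le_trans; apply.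
  (* At the last index the successor wraps to 0, so this right-hand factor is [impl1 \top c], which
     is [c]. *)
  apply: le_trans (meets_inf (j := ord_max) _ _) _ => //.
  by rewrite /f /= modnn impl1_1x nth_nil.
apply/meetsP => i _; rewrite /f /=.
have [->|ne] := eqVneq i ord_max; first by rewrite modnn /= nth_nil impl1_le ?lex1.
have lt_i : (i.+1 < n.+3)%N by rewrite ltn_neqAle ltn_ord andbT.
rewrite modn_small //; case: (nat_of_ord i) => [|[|k]] /=.
- by rewrite impl1_1x.
- by rewrite bc lex1.
- by rewrite !nth_nil impl1_le ?lex1.
Qed.

(** * Equational axiomatizations *)

Lemma ol_eval_bigmeet d (L : orthoLatticeType d) (v : nat -> L) n
    (t : 'I_n -> ol_term) :
  ol_eval v (\big[OLMeet/OLTop]_(i < n) t i) = \meet_(i < n) ol_eval v (t i).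
Proof. exact: (big_morph (ol_eval v)). Qed.

Definition ol_impl1 (s t : ol_term) := OLJoin (OLCompl s) (OLMeet s t).

Lemma nGo_variety n : is_variety (@nGo n).
Proof.
pose x (i : 'I_n) := OLVar i.
exists (fun s t => s = \big[OLMeet/OLTop]_(i < n) ol_impl1 (x i) (x (ordS i))
            /\ t = \big[OLMeet/OLTop]_(i < n) ol_impl1 (x (ordS i)) (x i)).
move=> d L; split=> [Go _ _ [-> ->] v|eqL a].
  by rewrite !ol_eval_bigmeet; exact: Go (fun i => v i).
(* The value [\top] beyond [n] is arbitrary: the terms only mention variables of index below [n]. *)
pose v k := oapp a \top (insub k).
have evalE i j : ol_eval v (ol_impl1 (x i) (x j)) = impl1 (a i) (a j).
  by rewrite /= /v !valK.
have := eqL _ _ (conj erefl erefl) v; rewrite !ol_eval_bigmeet.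
by under eq_bigr do rewrite evalE; under [X in _ = X]eq_bigr do rewrite evalE.
Qed.

(** The side condition [a <= b] disappears on replacing [b] by the join of [a] and [b], which equals
    [b] when the condition holds. *)
Lemma orthomodular_variety : is_variety (@orthomodular).
Proof.
pose x := OLVar 0; pose y := OLVar 1.
exists (fun s t => s = OLJoin x y /\
          t = OLJoin x (OLMeet (OLCompl x) (OLJoin x y))).
move=> d L; split=> [OM _ _ [-> ->] v|eqL a b ab]; first exact: OM (leUl _ _).
have /(_ (fun i => if i is 0 then a else b)) := eqL _ _ (conj erefl erefl).
by rewrite /= (join_r ab).
Qed.

(** * Orthomodular lattices from orthogonality graphs *)

Record orthograph := Orthograph {
  vertex :> finType;
  orth : rel vertex;
  orth_sym : symmetric orth;
  orth_irr : irreflexive orth;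
  orth_uniq : forall x y z w : vertex,
    orth z x -> orth z y -> orth w x -> orth w y -> x = y \/ z = w;
  orth_triangle : forall x y : vertex, orth x y ->
    exists z, orth z x && orth z y }.

Lemma pick_orth (G : orthograph) (x y z : G) : x != y ->
  orth z x -> orth z y -> [pick t | orth t x & orth t y] = Some z.
Proof.
move=> ne zx zy; case: pickP => [t /andP[tx ty]|/(_ z)]; last by rewrite zx zy.
by have [/eqP|->] := orth_uniq zx zy tx ty; rewrite // (negbTE ne).
Qed.

Lemma orth_neq (G : orthograph) (x y : G) : orth x y -> x != y.
Proof. by apply: contraTneq => ->; rewrite orth_irr. Qed.

(* [(false, None)], [(true, None)], [(false, Some x)] and [(true, Some x)] are
   the bottom, the top, the atom [x] and its orthocomplement. *)
Definition graph_ol (G : orthograph) : Type := bool * option G.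

HB.instance Definition _ G := Choice.copy (graph_ol G) (bool * option G)%type.

Definition graph_le G (u v : graph_ol G) : bool :=
  match u, v with
  | (false, None), _ | _, (true, None) => true
  | (false, Some x), (true, Some y) => orth x y
  | (false, Some x), (false, Some y) | (true, Some x), (true, Some y) => x == y
  | _, _ => false
  end.

Definition graph_compl G (u : graph_ol G) : graph_ol G := (~~ u.1, u.2).

(** A failed [pick] gives [(false, None)], so coatoms without a common neighbour meet in the
    bottom. *)
Definition graph_meet G (u v : graph_ol G) : graph_ol G :=
  match u, v with
  | (true, None), w | w, (true, None) => w
  | (false, None), _ | _, (false, None) => (false, None)
  | (false, Some x), (false, Some y) => (false, if x == y then Some x else None)
  | (false, Some x), (true, Some y) | (true, Some y), (false, Some x) =>
    (false, if orth x y then Some x else None)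
  | (true, Some x), (true, Some y) =>
    if x == y then u else (false, [pick z | orth z x && orth z y])
  end.

Definition graph_join G (u v : graph_ol G) : graph_ol G :=
  graph_compl (graph_meet (graph_compl u) (graph_compl v)).

Lemma graph_le_refl G : reflexive (@graph_le G).
Proof. by case=> [[] [x|]] /=. Qed.

Lemma graph_le_anti G : antisymmetric (@graph_le G).
Proof.
by move=> [[] [x|]] [[] [y|]] //= /andP[] // /eqP->.
Qed.

Lemma graph_le_trans G : transitive (@graph_le G).
Proof.
move=> [[] [y|]] [[] [x|]] [[] [z|]] //=; do ?[by move/eqP->]; do ?[by move=> + /eqP<-].
Qed.

Lemma graph_complK G : involutive (@graph_compl G).
Proof. by case=> b o; rewrite /graph_compl /= negbK. Qed.

Lemma graph_compl_anti G (u v : graph_ol G) :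
  graph_le u v -> graph_le (graph_compl v) (graph_compl u).
Proof.
case: u v => [[] [x|]] [[] [y|]] //=; rewrite 1?eq_sym //.
by rewrite orth_sym.
Qed.

Lemma graph_meetP G (u v w : graph_ol G) :
  graph_le u (graph_meet v w) = graph_le u v && graph_le u w.
Proof.
case: u v w => [[] [x|]] [[] [y|]] [[] [z|]] //=; rewrite ?andbT ?andbF //.
- case: eqVneq => [->|ne] //=; first by rewrite andbb.
  by apply/esym/negbTE; apply: contra ne => /andP[/eqP<- /eqP->].
- by case: eqVneq.
(* An atom below two distinct coatoms is a common neighbour of their vertices; by [orth_uniq] it is
   the one picked. *)
- case: eqVneq => [->|ne] /=; first by rewrite andbb.
  apply/idP/andP => [|[xy xz]].
    by case: pickP => // t /andP[ty tz] /eqP ->.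
  by rewrite (pick_orth ne xy xz) eqxx.
- case: ifP => [zy|]; first by case: eqVneq => [->|]; rewrite ?zy ?andbF.
  by case: eqVneq => [->|]; rewrite ?andbF // andbT => ->.
- case: ifP => [yz|]; first by case: eqVneq => [->|] //=; rewrite yz.
  by case: eqVneq => [->|] //=  ->.
- case: (eqVneq y z) => [->|ne]; rewrite ?andbb //.
  by case: eqVneq => [->|]; rewrite ?(negbTE ne).
Qed.

Lemma graph_joinP G (u v w : graph_ol G) :
  graph_le (graph_join u v) w = graph_le u w && graph_le v w.
Proof.
have complE (s t : graph_ol G) :
    graph_le s t = graph_le (graph_compl t) (graph_compl s).
  by apply/idP/idP => /graph_compl_anti //; rewrite !graph_complK.
by rewrite complE graph_complK graph_meetP -!complE.
Qed.

Lemma graph_le0x G (u : graph_ol G) : graph_le (false, None) u.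
Proof. by []. Qed.

Lemma graph_lex1 G (u : graph_ol G) : graph_le u (true, None).
Proof. by case: u => [[] [x|]]. Qed.

Lemma graph_meet_compl G (u : graph_ol G) :
  graph_meet u (graph_compl u) = (false, None).
Proof. by case: u => [[] [x|]] //=; rewrite orth_irr. Qed.

Lemma graph_join_compl G (u : graph_ol G) :
  graph_join u (graph_compl u) = (true, None).
Proof. by rewrite /graph_join graph_meet_compl. Qed.

Fact graph_display : Order.disp_t. Proof. exact: Order.Disp tt tt. Qed.

HB.instance Definition _ G := Order.Le_isPOrder.Build graph_display (graph_ol G)
  (@graph_le_refl G) (@graph_le_anti G) (@graph_le_trans G).

HB.instance Definition _ G := Order.POrder_MeetJoin_isLattice.Build
  graph_display (graph_ol G) (@graph_meetP G) (@graph_joinP G).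

HB.instance Definition _ G := Order.hasBottom.Build
  graph_display (graph_ol G) (@graph_le0x G).

HB.instance Definition _ G := Order.hasTop.Build
  graph_display (graph_ol G) (@graph_lex1 G).

HB.instance Definition _ G := TBLattice_hasOrthocomplement.Build
  graph_display (graph_ol G) (@graph_complK G) (@graph_compl_anti G)
  (@graph_meet_compl G) (@graph_join_compl G).

Lemma graph_meet_coatoms (G : orthograph) (x y z : G) : x != y ->
  orth z x -> orth z y ->
  graph_meet (true, Some x) (true, Some y) = (false, Some z).
Proof. by move=> ne zx zy; rewrite /= (negbTE ne) (pick_orth ne zx zy). Qed.

Lemma graph_join_atoms (G : orthograph) (x y z : G) : x != y ->
  orth z x -> orth z y ->
  graph_join (false, Some x) (false, Some y) = (true, Some z).
Proof. by move=> ne zx zy; rewrite /graph_join (graph_meet_coatoms ne zx zy). Qed.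

Lemma graph_orthomodular G : orthomodular (graph_ol G).
Proof.
move=> a b ab; have [->|nab] := eqVneq a b.
  by rewrite meetC meet_ocompl joinx0.
case: a b ab nab => [[] [x|]] [[] [y|]] //.
- by move=> /eqP->; rewrite eqxx.
- by rewrite (meet_l (lex1 _)) join_ocompl.
(* The only substantial case, x < y'. In a triangle x, y, z the meet x' /\ y' is z, and y is the
   common neighbour of x and z, so x \/ z = y'. *)
- move=> xy _; have [z /andP[zx zy]] := orth_triangle xy.
  have nxy := orth_neq xy.
  rewrite [X in _ `|` X](graph_meet_coatoms nxy zx zy).
  rewrite [RHS](@graph_join_atoms G x z y) // ?[orth y _]orth_sym //.
  by rewrite eq_sym orth_neq.
- by move=> _ _; rewrite (meet_l (lex1 _)) join_ocompl.
- by move=> /eqP->; rewrite eqxx.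
Qed.

(** Here z is x' /\ y', so the implication is x \/ z, the orthocomplement of the common neighbour w
    of x and z. *)
Lemma graph_impl1 (G : orthograph) (x y z w : G) : x != y ->
    orth z x -> orth z y -> orth w x -> orth w z ->
  impl1 ((true, Some x) : graph_ol G) (true, Some y) = (true, Some w).
Proof.
move=> ne zx zy wx wz; rewrite /impl1 [_ `&` _](graph_meet_coatoms ne zx zy).
by apply: graph_join_atoms; rewrite // eq_sym orth_neq.
Qed.


(** * Godowski's wheel and the failure of n-Go *)

(* 0 is the centre, and for i = 1, 2, 3 (cyclically) g_i = i, d_i = i + 6,
   e_i = i + 9 and h_i = i + 12; the blocks are {0, g_i, i + 3},
   {d_i, e_i, g_i} and {e_i, h_i, d_{i+1}}. *)
Definition godowski_blocks : seq (seq nat) :=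
  [:: [:: 0; 1; 4]; [:: 7; 10; 1]; [:: 10; 13; 8];
      [:: 0; 2; 5]; [:: 8; 11; 2]; [:: 11; 14; 9];
      [:: 0; 3; 6]; [:: 9; 12; 3]; [:: 12; 15; 7]]%N.

Definition godowski_orth (x y : nat) : bool :=
  (x != y) && has (fun B => (x \in B) && (y \in B)) godowski_blocks.

(** Reduces statements about all vertices to boolean checks on lists of naturals, which [vm_compute]
    can evaluate. *)
Lemma all_ord n (P : pred nat) : all P (iota 0 n) -> forall i : 'I_n, P i.
Proof. by move=> /allP allP i; apply: allP; rewrite mem_iota ltn_ord. Qed.

Lemma godowski_orth_sym : symmetric (fun x y : 'I_16 => godowski_orth x y).
Proof.
move=> x y; rewrite /godowski_orth eq_sym.
by congr (_ && _); apply: eq_has => B; rewrite andbC.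
Qed.

Lemma godowski_orth_irr : irreflexive (fun x y : 'I_16 => godowski_orth x y).
Proof. by move=> x; rewrite /godowski_orth eqxx. Qed.

Lemma godowski_orth_uniq (x y z w : 'I_16) :
  godowski_orth z x -> godowski_orth z y ->
  godowski_orth w x -> godowski_orth w y -> x = y \/ z = w.
Proof.
have checked : all (fun x => all (fun y => all (fun z => all (fun w =>
    [&& godowski_orth z x, godowski_orth z y, godowski_orth w x
      & godowski_orth w y] ==> (x == y) || (z == w))
    (iota 0 16)) (iota 0 16)) (iota 0 16)) (iota 0 16) by vm_compute.
have := all_ord (all_ord (all_ord (all_ord checked x) y) z) w.
move=> + zx zy wx wy; rewrite zx zy wx wy /=.
by case/orP => /eqP/val_inj; [left|right].
Qed.

Lemma godowski_orth_triangle (x y : 'I_16) : godowski_orth x y ->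
  exists z : 'I_16, godowski_orth z x && godowski_orth z y.
Proof.
have checked : all (fun x => all (fun y => godowski_orth x y ==>
    has (fun z => godowski_orth z x && godowski_orth z y) (iota 0 16))
    (iota 0 16)) (iota 0 16) by vm_compute.
have /implyP := all_ord (all_ord checked x) y.
move=> /[apply] /hasP[z]; rewrite mem_iota => /= lt_z xyz.
by exists (Ordinal lt_z).
Qed.

Definition godowski : orthograph :=
  Orthograph godowski_orth_sym godowski_orth_irr
    godowski_orth_uniq godowski_orth_triangle.

Lemma godowski_not_nGo n : (3 <= n)%N -> ~ nGo n (graph_ol godowski).
Proof.
case: n => [|[|[|n]]] // _ Go.
pose at_ k : godowski := inord k.
pose c k : graph_ol godowski := (true, Some (at_ k)).
(* The sequence is d_1', d_2', d_3', d_3', ...; each repetition only adds a factor [\top]. *)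
pose f (i : 'I_n.+3) := nth (c 9) [:: c 7; c 8] i.
have orthE j k : (j < 16)%N -> (k < 16)%N ->
    orth (at_ j) (at_ k) = godowski_orth j k.
  by move=> lt_j lt_k; rewrite /= !inordK.
have neqE j k : (j < 16)%N -> (k < 16)%N -> (at_ j != at_ k) = (j != k).
  by move=> lt_j lt_k; rewrite -val_eqE /= !inordK.
(* The centre is below every left-hand factor: these are g_1', g_2', g_3' and possibly [\top]. Each
   g_i' is computed through the common neighbour e_i of d_i and d_{i+1}. *)
have p_le : ((false, Some (at_ 0)) : graph_ol godowski) <=
    \meet_(i < n.+3) impl1 (f i) (f (ordS i)).
  apply/meetsP => i _; rewrite /f /=.
  have [->|ne] := eqVneq i ord_max.
    rewrite modnn /= nth_nil.
    rewrite (@graph_impl1 _ _ _ (at_ 12) (at_ 3)) ?neqE ?orthE //.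
    by rewrite [_ <= _]orthE.
  have lt_i : (i.+1 < n.+3)%N by rewrite ltn_neqAle ltn_ord andbT.
  rewrite modn_small //; case: (nat_of_ord i) => [|[|k]] /=.
  - rewrite (@graph_impl1 _ _ _ (at_ 10) (at_ 1)) ?neqE ?orthE //.
    by rewrite [_ <= _]orthE.
  - rewrite (@graph_impl1 _ _ _ (at_ 11) (at_ 2)) ?neqE ?orthE //.
    by rewrite [_ <= _]orthE.
  - by rewrite !nth_nil impl1_le ?lex1.
rewrite Go in p_le.
(* The first right-hand factor is d_2' ->1 d_1' = h_1', and the centre is not orthogonal to h_1. *)
have := le_trans p_le (meets_inf (j := ord0) _ isT).
rewrite /f /= (@graph_impl1 _ _ _ (at_ 10) (at_ 13)) ?neqE ?orthE //.
by rewrite [_ <= _]orthE.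
Qed.

Theorem theorem3p10 (n : nat) (hn : (3 <= n)%N) :
  (forall (R : realType) (d : Order.disp_t) (L : orthoLatticeType d),
     (exists a b : L, a <> b) ->
     (exists S : set (L -> R), strong_set_of_states S) ->
     nGo n L)
  /\
  [/\ is_variety (@nGo n),
      is_variety (@orthomodular),
      (forall (d : Order.disp_t) (L : orthoLatticeType d),
         nGo n L -> orthomodular L)
    & (exists (d : Order.disp_t) (L : orthoLatticeType d),
         orthomodular L /\ ~ nGo n L)].
Proof.
split=> [R d L _ [S strS]|]; first exact: nGo_of_strong_states strS.
split.
- exact: nGo_variety.
- exact: orthomodular_variety.
- by move=> d L; exact: orthomodular_of_nGo.
exists graph_display, (graph_ol godowski); split.
  exact: graph_orthomodular.
exact: godowski_not_nGo.
Qed.
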